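(* Let $k$ and $n$ be non-negative integers and $[n]=\{1,\dots,n\}$. The number of isomorphism classes of $k$-magmas on a set of cardinality $n$ (equivalently, the number of pairwise non-isomorphic $k$-magmas of the form $([n],\ast)$) equals \[ \sum_{j \in J_n} \frac{1}{\prod_{i=1}^n i^{j_i}\, j_i!} \prod_{(r_1,\dots,r_k)\in [n]^k} \bigg(\sum_{d\mid\operatorname{lcm}(r_1,\dots,r_k)} d\, j_d\bigg)^{\frac{r_1\cdots r_k}{\operatorname{lcm}(r_1,\dots,r_k)}\, j_{r_1}\cdots j_{r_k}}, \] where $J_n$ denotes the set of all sequences $j=(j_i)_{i=1}^{\infty}$ of non-negative integers such that $\sum_{i=1}^{\infty} i j_i = n$.
   Context: For a non-negative integer $k$, a $k$-magma is a set $M$ together with a map $\ast\colon M^k\to M$ (a $k$-ary operation); a $0$-magma is thus a set together with a distinguished element of it. Given $k$-magmas $(M,\ast)$ and $(N,\star)$, a $k$-magma homomorphism is a map $\phi\colon M\to N$ with $\phi(\ast(a_1,\dots,a_k))=\star(\phi(a_1),\dots,\phi(a_k))$ for all $a_1,\dots,a_k\in M$; an isomorphism is a bijective homomorphism, and two $k$-magmas are isomorphic if there is an isomorphism between them. Conventions: $0^0=1$; empty sums are $0$ and empty products are $1$; $\operatorname{lcm}(r_1,\dots,r_k)$ is defined to be $1$ when $k=0$ and $r_1$ when $k=1$; for $k=0$, $[n]^0$ consists of a single (empty) tuple. *)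

(* Defs.v *)
From mathcomp Require Import all_boot all_fingroup.

Set Implicit Arguments.
Unset Strict Implicit.
Unset Printing Implicit Defensive.

Definition magma_hom (k : nat) (M N : Type)
    (f : k.-tuple M -> M) (g : k.-tuple N -> N) (phi : M -> N) : Prop :=
  forall a : k.-tuple M, phi (f a) = g (map_tuple phi a).

Definition magma_isomorphic (k : nat) (M N : Type)
    (f : k.-tuple M -> M) (g : k.-tuple N -> N) : Prop :=
  exists2 phi : M -> N, magma_hom f g phi & bijective phi.

(* Boolean form of [magma_isomorphic] on one finite carrier, where the         *)
(* bijections M -> M are the permutations of M; see [magma_isomP].             *)
Definition magma_isom (k : nat) (M : finType) : rel {ffun k.-tuple M -> M} :=
  fun f g => [exists s : {perm M}, forall a, s (f a) == g (map_tuple s a)].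

Lemma magma_isomP (k : nat) (M : finType) (f g : {ffun k.-tuple M -> M}) :
  reflect (magma_isomorphic f g) (magma_isom f g).
Proof.
apply: (iffP existsP) => [[s /forallP sP]|[phi hom_phi bij_phi]].
  by exists s; [move=> a; apply/eqP | exists (perm_inv s); [exact: permK | exact: permKV]].
exists (perm (bij_inj bij_phi)); apply/forallP => a; apply/eqP.
rewrite permE hom_phi; congr (g _); apply/val_inj/eq_map => x /=.
by rewrite permE.
Qed.

Lemma magma_isom_equiv (k : nat) (M : finType) :
  equivalence_rel (@magma_isom k M).
Proof.
apply/equivalence_relP; split=> [f|f g fg h].
  apply/magma_isomP; exists id; last by exists id.
  by move=> a; congr (f _); apply/val_inj; rewrite /= map_id.
have sym f' g' : magma_isom f' g' -> magma_isom g' f'.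
  move=> /magma_isomP[u hu [v uK vK]]; apply/magma_isomP.
  exists v; last by exists u.
  move=> a; rewrite -[RHS]uK hu; congr (v (g' _)).
  by apply/val_inj; rewrite /= -map_comp map_id_in // => x _ /=; rewrite vK.
have trans f1 f2 f3 : magma_isom f1 f2 -> magma_isom f2 f3 -> magma_isom f1 f3.
  move=> /magma_isomP[u hu bu] /magma_isomP[v hv bv]; apply/magma_isomP.
  exists (v \o u); last exact: bij_comp.
  move=> a; rewrite /= hu hv; congr (f3 _).
  by apply/val_inj; rewrite /= -map_comp.
by apply/idP/idP; apply: trans; [apply: sym|].
Qed.

(* Every k-magma with n elements has an isomorphic copy on any given n-element *)
(* set, so counting isomorphism classes on one carrier loses nothing.          *)
Lemma magma_transport (k : nat) (M N : finType) (f : {ffun k.-tuple M -> M}) :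
  #|M| = #|N| -> exists g : {ffun k.-tuple N -> N}, magma_isomorphic f g.
Proof.
move=> e; pose u x := enum_val (cast_ord e (enum_rank x)).
pose v y := enum_val (cast_ord (esym e) (enum_rank y)).
have uK : cancel u v by move=> x; rewrite /u /v enum_valK cast_ordK enum_rankK.
have vK : cancel v u by move=> y; rewrite /u /v enum_valK cast_ordKV enum_rankK.
exists [ffun b => u (f (map_tuple v b))].
exists u; last by exists v.
move=> a; rewrite ffunE; congr (u (f _)); apply/val_inj.
by rewrite /= -map_comp map_id_in // => x _ /=; rewrite uK.
Qed.

Definition magma_iso_classes (k : nat) (M : finType) :
    {set {set {ffun k.-tuple M -> M}}} :=
  equivalence_partition (@magma_isom k M) [set: {ffun k.-tuple M -> M}].

(* A sequence (j_1, j_2, ...) of naturals with \sum_i i * j_i = n satisfies    *)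
(* j_i <= n for all i, and j_i = 0 for i > n; it is encoded by its first n     *)
(* terms, j_i being stored at the ordinal i - 1. [mult j i] is j_i, for        *)
(* every i >= 1. Lemmas [Jset_sum], [Jset_inj] and [Jset_onto] say that this   *)
(* encoding is a bijection.                                                    *)
Definition mult (n : nat) (j : {ffun 'I_n -> 'I_n.+1}) (i : nat) : nat :=
  if i is i'.+1 then oapp (fun o : 'I_n => j o : nat) 0 (insub i') else 0.

Definition Jset (n : nat) : {set {ffun 'I_n -> 'I_n.+1}} :=
  [set j | \sum_(1 <= i < n.+1) i * mult j i == n].

Lemma mult_ord (n : nat) (j : {ffun 'I_n -> 'I_n.+1}) (i : 'I_n) :
  mult j i.+1 = j i.
Proof. by rewrite /mult valK. Qed.

Lemma mult_gt (n : nat) (j : {ffun 'I_n -> 'I_n.+1}) (i : nat) :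
  n < i -> mult j i = 0.
Proof. by case: i => // i; rewrite ltnS /mult => ni; rewrite insubN // -leqNgt. Qed.

Lemma Jset_sum (n : nat) (j : {ffun 'I_n -> 'I_n.+1}) (N : nat) :
  j \in Jset n -> n <= N -> \sum_(1 <= i < N.+1) i * mult j i = n.
Proof.
rewrite inE => /eqP jn nN; rewrite (@big_cat_nat _ _ _ n.+1) //= jn.
rewrite big_nat big1 ?addn0 // => i /andP[ni _].
by rewrite mult_gt // muln0.
Qed.

Lemma Jset_inj (n : nat) (j1 j2 : {ffun 'I_n -> 'I_n.+1}) :
  (forall i, 0 < i -> mult j1 i = mult j2 i) -> j1 = j2.
Proof.
by move=> e; apply/ffunP => i; apply/val_inj; rewrite /= -!mult_ord e.
Qed.

Lemma Jset_onto (n N : nat) (f : nat -> nat) :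
  (forall i, N < i -> f i = 0) -> \sum_(1 <= i < N.+1) i * f i = n ->
  exists2 j, j \in Jset n & forall i, 0 < i -> mult j i = f i.
Proof.
move=> f0 fn.
have le i : 0 < i -> i * f i <= n.
  move=> i0; case: (ltnP N i) => [/f0->|iN]; first by rewrite muln0.
  rewrite -fn (bigD1_seq i) ?iota_uniq ?mem_index_iota ?i0 //=; exact: leq_addr.
have fgt i : n < i -> f i = 0.
  move=> ni; have := le i (leq_ltn_trans (leq0n _) ni).
  by case: (f i) => // m; rewrite leqNgt (leq_trans ni) // leq_pmulr.
have fle i : 0 < i -> f i < n.+1.
  by move=> i0; rewrite ltnS (leq_trans _ (le i i0)) // leq_pmull.
pose j := [ffun i : 'I_n => Ordinal (fle i.+1 isT)].
have jE i : 0 < i -> mult j i = f i.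
  case: i => // i _; case: (ltnP i n) => [i_n|ni].
    by rewrite (mult_ord j (Ordinal i_n)) ffunE.
  by rewrite mult_gt ?fgt.
exists j => //; rewrite inE; apply/eqP; rewrite -[RHS]fn.
pose m := maxn n N.
have ext p (h : nat -> nat) : p <= m -> (forall i, p < i -> h i = 0) ->
    \sum_(1 <= i < p.+1) i * h i = \sum_(1 <= i < m.+1) i * h i.
  move=> pm h0; rewrite [RHS](@big_cat_nat _ _ _ p.+1) //= [X in _ + X]big_nat.
  by rewrite [X in _ + X]big1 ?addn0 // => i /andP[pi _]; rewrite h0 ?muln0.
rewrite (ext n) ?leq_maxl //; last by move=> i; exact: mult_gt.
rewrite (ext N f) ?leq_maxr //.
by apply: eq_big_nat => i /andP[i0 _]; rewrite jE.
Qed.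

(* [n]^k is encoded by k-tuples r over 'I_n, with r_i = (tnth r i).+1. *)
Definition entry (n k : nat) (r : k.-tuple 'I_n) (i : 'I_k) : nat :=
  (tnth r i).+1.

Definition lcm_entries (n k : nat) (r : k.-tuple 'I_n) : nat :=
  \big[lcmn/1]_(i < k) entry r i.

(* The quotient below is exact. *)
Lemma lcm_entries_dvd (n k : nat) (r : k.-tuple 'I_n) :
  lcm_entries r %| \prod_(i < k) entry r i.
Proof.
rewrite /lcm_entries; elim/big_ind2: _ => //= a b c d ab cd.
by rewrite dvdn_lcm dvdn_mulr ?dvdn_mull.
Qed.

Lemma lcm_entries_gt0 (n k : nat) (r : k.-tuple 'I_n) : 0 < lcm_entries r.
Proof. by rewrite /lcm_entries; elim/big_ind: _ => // a b; rewrite lcmn_gt0 => -> ->. Qed.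

(* Main.v *)
(* Permutations of [M] act on the k-magma structures on [M] by transport, and
   the orbits are the isomorphism classes, so Burnside's formula applies.
   A magma fixed by [s] is a map h with h (s a) = s (h a); it is determined by
   the image of one tuple from each cycle of [s] on M^k, and that image may be
   any point whose order under [s] divides the length of the cycle.  The length
   of the cycle of a tuple is the lcm of the orders of its entries, so there
   are (r_1 ... r_k / lcm) j_{r_1} ... j_{r_k} cycles of tuples whose entries
   have orders r_1, ..., r_k, and each allows \sum_(d | lcm) d j_d images.
   The permutations of cycle type j are counted through the n! injections u
   of a model [X] of cycle type j into [M]: u conjugates the model permutation
   to exactly one t, and each t of type j arises from \prod_i i^{j_i} j_i! of
   them, u being determined by a point in each cycle of t, after a numbering of
   the cycles of each length. *)

Require Import Defs.
From mathcomp Require Import all_boot all_fingroup all_algebra.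

Set Implicit Arguments.
Unset Strict Implicit.
Unset Printing Implicit Defensive.

Local Notation forder := fingraph.order.

(** * Cardinalities from inverse maps and dependent choices *)

Lemma can2_in_eq_card (A B : finType) (P : {pred A}) (Q : {pred B})
    (u : A -> B) (v : B -> A) :
  {homo u : x / x \in P >-> x \in Q} -> {homo v : y / y \in Q >-> y \in P} ->
  {in P, cancel u v} -> {in Q, cancel v u} -> #|P| = #|Q|.
Proof.
move=> uPQ vQP uK vK; rewrite -(card_in_imset (can_in_inj uK)).
apply: eq_card => y; apply/imsetP/idP => [[x /uPQ Qux ->] //|Qy].
by exists (v y); rewrite ?vK ?vQP.
Qed.

Lemma card_family_prod (I : finType) (T : I -> finType)
    (F : forall i, pred (T i)) :
  #|(family F : simpl_pred {dffun forall i, T i})| = \prod_i #|F i|.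
Proof. by rewrite card_family foldrE big_map big_enum. Qed.

(** * Cycle lengths and iterates of an injective self-map *)

Section Cycles.
Variables (T : finType) (f : T -> T).
Hypothesis f_inj : injective f.

Lemma iter_muln_order (q : nat) (x : T) : iter (q * forder f x) f x = x.
Proof. by elim: q => // q IHq; rewrite mulSn iterD IHq iter_order. Qed.

Lemma iter_mod_order (m : nat) (x : T) :
  iter (m %% forder f x) f x = iter m f x.
Proof. by rewrite [in RHS](divn_eq m (forder f x)) addnC iterD iter_muln_order. Qed.

Lemma iter_eq_dvdn (m : nat) (x : T) : (iter m f x == x) = (forder f x %| m).
Proof.
rewrite -iter_mod_order /dvdn; set r := m %% _.
have r_lt : r < forder f x by rewrite ltn_mod fingraph.order_gt0.
apply/eqP/eqP => [rx | -> //].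
by rewrite -(findex_iter r_lt) rx findex0.
Qed.

Lemma order_f (x : T) : forder f (f x) = forder f x.
Proof. by apply: eq_card => y; rewrite !inE -same_fconnect1. Qed.

Lemma card_order_set (d : nat) :
  fcard f (order_set f d) * d = #|order_set f d|.
Proof.
apply: fcard_order_set => //.
by move=> x _ /eqP <-; rewrite !inE order_f.
Qed.

(** A point is fixed by the [m]-th iterate exactly when its order divides [m], and the points of
    order [d] fill cycles of [d] points each. *)
Lemma card_iter_fixed (m : nat) : 0 < m ->
  #|[pred x | iter m f x == x]|
    = \sum_(d <- divisors m) d * fcard f (order_set f d).
Proof.
move=> m_gt0; transitivity (\sum_(d <- divisors m) \sum_(x | forder f x == d) 1).
  rewrite -sum1_card (exchange_big_dep predT) //= big_mkcond /=.
  apply: eq_bigr => x _; rewrite inE iter_eq_dvdn.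
  rewrite sum1_count (eq_count (a2 := pred1 (forder f x))); last first.
    by move=> d; rewrite /= eq_sym.
  by rewrite count_uniq_mem ?divisors_uniq // -dvdn_divisors //.
by apply: eq_bigr => d _; rewrite sum1_card mulnC card_order_set.
Qed.

End Cycles.

(** * Equivariant maps and cycles on tuples *)

Lemma card_equivariant (A B : finType) (g : A -> A) (f : B -> B) :
  injective g -> injective f ->
  #|[pred h : {ffun A -> B} | [forall a, h (g a) == f (h a)]]|
    = \prod_(a in froots g) #|[pred y | iter (forder g a) f y == y]|.
Proof.
move=> g_inj f_inj; have symg := fconnect_sym g_inj.
pose R := {a | a \in froots g}.
have root_in a : froot g a \in froots g by exact: roots_root.
pose root_of a : R := Sub (froot g a) (root_in a).
pose F (r : R) := [pred y | iter (forder g (val r)) f y == y].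
rewrite big_sub -(card_family_prod F).
(* [u] restricts to one root per cycle of [g]; its inverse [v] spreads the value at a root along the
   cycle by iterating [f]. *)
pose u (h : {ffun A -> B}) : {ffun R -> B} := [ffun r => h (val r)].
pose v (h : {ffun R -> B}) : {ffun A -> B} :=
  [ffun a => iter (findex g (froot g a) a) f (h (root_of a))].
have iterE (h : {ffun A -> B}) : [forall a, h (g a) == f (h a)] ->
    forall m a, h (iter m g a) = iter m f (h a).
  by move=> /forallP hP; elim=> // m IHm a; rewrite !iterS (eqP (hP _)) IHm.
have rootK a : iter (findex g (froot g a) a) g (froot g a) = a.
  by apply: iter_findex; rewrite symg connect_root.
apply: (can2_in_eq_card (u := u) (v := v)).
- move=> h; rewrite inE => /iterE hP; apply/familyP => r.
  by rewrite !inE ffunE -hP iter_order.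
- move=> h /familyP hF; rewrite inE; apply/forallP => a; apply/eqP.
  have eq_root : root_of (g a) = root_of a.
    apply: val_inj => /=; apply/esym/eqP.
    by rewrite (root_connect symg) fconnect1.
  rewrite !ffunE eq_root.
  set x := froot g a; set y := h _.
  have -> : froot g (g a) = x by exact: (congr1 (fun r : R => val r) eq_root).
  (* The value [y] at the root returns to itself after [forder g x] steps of [f], so exponents
     matter only modulo that length; this settles the step where [g] closes its cycle. *)
  have yP m : iter (m %% forder g x) f y = iter m f y.
    rewrite -(iter_mod_order f_inj) modn_dvdm ?(iter_mod_order f_inj) //.
    by rewrite -(iter_eq_dvdn f_inj); exact: hF (root_of a).
  rewrite -iterS -[RHS]yP; congr (iter _ f y).
  rewrite -[X in findex g x (g X)]rootK -iterS -/x -(iter_mod_order g_inj).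
  by rewrite findex_iter // ltn_mod fingraph.order_gt0.
- move=> h; rewrite inE => /iterE hP; apply/ffunP => a.
  by rewrite !ffunE /= -hP rootK.
- move=> h _; apply/ffunP => r; rewrite !ffunE.
  have rr : froot g (val r) = val r by apply/eqP; exact: (valP r).
  have -> : root_of (val r) = r by exact: val_inj.
  by rewrite rr findex0.
Qed.

(** Both numbers have the same multiples, since an iterate fixes a tuple exactly when it fixes every
    entry. *)
Lemma order_map_tuple (k : nat) (T : finType) (f : T -> T) (a : k.-tuple T) :
  injective f ->
  forder (@map_tuple k T T f) a = \big[lcmn/1]_(i < k) forder f (tnth a i).
Proof.
move=> f_inj.
have F_inj : injective (@map_tuple k T T f).
  by move=> b c /(congr1 val) /(inj_map f_inj) /val_inj.
have iter_tnth m i : tnth (iter m (@map_tuple k T T f) a) i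
                      = iter m f (tnth a i).
  by elim: m => //= m IHm; rewrite tnth_map IHm.
have dvdE m : (forder (@map_tuple k T T f) a %| m)
            = (\big[lcmn/1]_(i < k) forder f (tnth a i) %| m).
  rewrite -(iter_eq_dvdn F_inj); apply/eqP/dvdn_biglcmP => [am i _|am].
    by rewrite -(iter_eq_dvdn f_inj) -iter_tnth am.
  apply: eq_from_tnth => i; rewrite iter_tnth; apply/eqP.
  by rewrite (iter_eq_dvdn f_inj) am.
by apply/eqP; rewrite eqn_dvd dvdE dvdnn -dvdE dvdnn.
Qed.

Lemma card_tuple_family (k : nat) (T : finType) (F : 'I_k -> pred T) :
  #|[pred a : k.-tuple T | [forall i, F i (tnth a i)]]| = \prod_i #|F i|.
Proof.
rewrite -card_family_prod.
apply: (can2_in_eq_card (u := fun a => [ffun i => tnth a i])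
                        (v := fun h => [tuple h i | i < k])) => [a|h|a|h] /=.
- by rewrite inE => /forallP aF; apply/familyP => i; rewrite ffunE; exact: aF.
- move=> /familyP hF; rewrite inE; apply/forallP => i.
  by rewrite tnth_mktuple; exact: hF.
- by move=> _; apply: eq_from_tnth => i; rewrite tnth_mktuple ffunE.
- by move=> _; apply/ffunP => i; rewrite ffunE tnth_mktuple.
Qed.

(** The factors of [card_equivariant] are grouped by the orders of the entries of the root tuple.
    This shape determines the cycle length, hence the factor, and the exponent is the number of
    cycles of that shape. *)
Lemma card_tuple_equivariant (k : nat) (T : finType) (f : T -> T) :
  injective f ->
  #|[pred h : {ffun k.-tuple T -> T} |
      [forall a, h (map_tuple f a) == f (h a)]]|
    = \prod_(r : k.-tuple 'I_#|T|)
        (\sum_(d <- divisors (lcm_entries r)) d * fcard f (order_set f d))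
          ^ (((\prod_(i < k) entry r i) %/ lcm_entries r)
              * \prod_(i < k) fcard f (order_set f (entry r i))).
Proof.
move=> f_inj.
have F_inj : injective (@map_tuple k T T f).
  by move=> b c /(congr1 val) /(inj_map f_inj) /val_inj.
(* Orders lie between 1 and [#|T|]; [entry] adds 1 back, so the shape stores predecessors. *)
have ord_lt x : (forder f x).-1 < #|T|.
  by rewrite fingraph.orderSpred; exact: max_card.
pose shape (a : k.-tuple T) := [tuple Ordinal (ord_lt (tnth a i)) | i < k].
have entry_shape a i : entry (shape a) i = forder f (tnth a i).
  by rewrite /entry tnth_mktuple /= fingraph.orderSpred.
have lcm_shape a : lcm_entries (shape a) = forder (@map_tuple k T T f) a.
  by rewrite order_map_tuple //; apply: eq_bigr => i _; rewrite entry_shape.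
rewrite card_equivariant // (partition_big shape predT) //=.
apply: eq_bigr => r _.
rewrite (eq_bigr (fun=> \sum_(d <- divisors (lcm_entries r))
    d * fcard f (order_set f d))); last first.
  move=> a /andP[_ /eqP <-].
  by rewrite -card_iter_fixed ?lcm_entries_gt0 // lcm_shape.
pose R := [predI froots (@map_tuple k T T f) & [pred a | shape a == r]].
rewrite (eq_bigl (mem R)) // prod_nat_const; congr (_ ^ _).
have shapeE a : (shape a == r) = [forall i, order_set f (entry r i) (tnth a i)].
  apply/eqP/forallP => [<- i | ar]; first by apply/eqP; rewrite entry_shape.
  apply: eq_from_tnth => i; apply: val_inj; apply: succn_inj.
  by rewrite -[LHS]/(entry _ i) entry_shape; exact/eqP/ar.
have card_R : #|R| * lcm_entries r = #|[pred a | shape a == r]|.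
  apply: (fcard_order_set F_inj (a := [pred a | shape a == r])).
    by apply/subsetP => a; rewrite !inE => /eqP <-; rewrite lcm_shape.
  move=> a _ /eqP <-; rewrite !inE !shapeE.
  by apply: eq_forallb => i; rewrite tnth_map /order_set /= order_f.
(* After multiplication by the common cycle length, both sides count the tuples of shape [r], entry
   by entry. *)
apply/eqP; rewrite -(eqn_pmul2r (lcm_entries_gt0 r)) card_R mulnAC.
rewrite divnK ?lcm_entries_dvd // -big_split /= (eq_card shapeE).
rewrite (card_tuple_family (fun i => order_set f (entry r i))).
by apply/eqP/eq_bigr => i _; rewrite -card_order_set // mulnC.
Qed.

(** * Marked points in the cycles of one length *)

Section Transversals.
Variables (T : finType) (f : T -> T).
Hypothesis f_inj : injective f.

Lemma order_froot (x : T) : forder f (froot f x) = forder f x.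
Proof.
apply: eq_card => y; have symf := fconnect_sym f_inj.
by rewrite !inE -(same_connect symf (connect_root _ x)).
Qed.

(** A numbering by [I] of distinct cycles of length [d], with a marked point in each; the root
    stands for the cycle. *)
Definition transversal_fun (I : finType) (d : nat) : pred {ffun I -> T} :=
  [pred g : {ffun I -> T} | [forall a, order_set f d (g a)]
             && injectiveb [ffun a => froot f (g a)]].
Arguments transversal_fun : clear implicits.

(** Passing to roots leaves a bijective numbering of the cycles, which gives the factorial; each
    fibre is a free choice among the [d] points of every cycle. *)
Lemma card_transversal_fun (d : nat) :
  #|transversal_fun 'I_(fcard f (order_set f d)) d|
    = (fcard f (order_set f d))`! * d ^ fcard f (order_set f d).
Proof.
set m := fcard _ _; have symf := fconnect_sym f_inj.
pose R := [predI froots f & order_set f d].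
pose S := [set h in ffun_on R | injectiveb (h : {ffun 'I_m -> T})].
pose roots (g : {ffun 'I_m -> T}) := [ffun a => froot f (g a)].
have rootsS g : g \in transversal_fun 'I_m d -> roots g \in S.
  rewrite !inE => /andP[/forallP g_d ->]; rewrite andbT; apply/ffun_onP => a.
  by rewrite ffunE !inE roots_root // order_froot; exact: g_d.
rewrite -sum1_card (partition_big roots (mem S)) //=.
rewrite (eq_bigr (fun=> d ^ m)) => [|h]; last first.
  rewrite inE => /andP[/ffun_onP hR h_inj].
  rewrite sum1_card; transitivity #|family (fun a => fconnect f (h a))|.
    apply: eq_card => g; rewrite !inE; apply/idP/familyP => [|gh].
      by case/andP=> _ /eqP <- a; rewrite ffunE !inE symf connect_root.
    have rg a : froot f (g a) = h a.
      have /andP[/eqP hr _] := hR a.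
      by rewrite -[RHS]hr; apply/eqP; rewrite (root_connect symf) symf; exact: gh.
    have gh_eq : roots g = h by apply/ffunP => a; rewrite ffunE rg.
    apply/andP; split; last exact/eqP.
    rewrite inE -/(roots g) gh_eq h_inj andbT.
    apply/forallP => a; rewrite /order_set /= -order_froot rg.
    by have /andP[_ ] := hR a.
  rewrite card_family_prod (eq_bigr (fun=> d)).
    by rewrite prod_nat_const card_ord.
  by move=> a _; have /andP[_ /eqP] := hR a.
rewrite sum_nat_const card_inj_ffuns_on card_ord; congr (_ * _).
by rewrite ffactnn.
Qed.

End Transversals.
Arguments transversal_fun {T} f I d.

(** * The model permutation of a given cycle type *)

Section ModelCycles.
Variables (n : nat) (m : 'I_n -> nat).

(* The model permutation with [m i] cycles of length [i.+1]. *)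
Definition cycle_points : finType := {i : 'I_n & ('I_(m i) * 'I_i.+1)%type}.

Definition cycle_point (i : 'I_n) (a : 'I_(m i)) (b : 'I_i.+1) : cycle_points :=
  Tagged (fun i : 'I_n => ('I_(m i) * 'I_i.+1)%type) (a, b).

Definition rotate (x : cycle_points) : cycle_points :=
  cycle_point (tagged x).1 (ordS (tagged x).2).

Lemma card_tag_cycle_points (i : 'I_n) :
  #|[pred x : cycle_points | tag x == i]| = m i * i.+1.
Proof.
rewrite -[X in X * _]card_ord -[X in _ * X]card_ord.
rewrite -card_prod -cardsT -(card_imset _ (f := fun p => cycle_point p.1 p.2)).
  apply: eq_card => x; rewrite inE; apply/eqP/imsetP => [<-|[p _ ->] //].
  by exists (tagged x) => //; case: x => i' [].
by move=> [a b] [a' b'] /= /eqP; rewrite -tag_eqE /tag_eq eqxx /= tagged_asE => /eqP.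
Qed.

Lemma card_cycle_points : #|cycle_points| = \sum_(i < n) i.+1 * m i.
Proof.
rewrite -sum1_card (partition_big (fun x : cycle_points => tag x) predT) //=.
by apply: eq_bigr => i _; rewrite sum1_card card_tag_cycle_points mulnC.
Qed.

Lemma rotate_inj : injective rotate.
Proof.
apply: (can_inj (g := fun x => cycle_point (tagged x).1 (ord_pred (tagged x).2))).
by case=> i [a b]; rewrite /cycle_point /= ordSK.
Qed.

Lemma iter_rotate (q : nat) (i : 'I_n) (a : 'I_(m i)) (b : 'I_i.+1) :
  iter q rotate (cycle_point a b) = cycle_point a (iter q (@ordS _) b).
Proof. by elim: q => //= q ->. Qed.

Lemma iter_ordS (p q : nat) (b : 'I_p) : iter q (@ordS _) b = (b + q) %% p :> nat.
Proof.
elim: q => [|q IHq] /=; first by rewrite addn0 modn_small.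
by rewrite IHq -addn1 modnDml addn1 addnS.
Qed.

Lemma order_rotate (x : cycle_points) : forder rotate x = (tag x).+1.
Proof.
case: x => i [a b]; change (forder rotate (cycle_point a b) = i.+1).
have dvdE q : (forder rotate (cycle_point a b) %| q) = (i.+1 %| q).
  rewrite -(iter_eq_dvdn rotate_inj) iter_rotate.
  transitivity (iter q (@ordS _) b == b).
    rewrite -tag_eqE /tag_eq eqxx /= tagged_asE xpair_eqE eqxx //.
  rewrite -val_eqE /= iter_ordS -[X in _ == X](modn_small (ltn_ord b)).
  by rewrite -[X in _ == X %% _]addn0 eqn_modDl mod0n.
by apply/eqP; rewrite eqn_dvd dvdE dvdnn -dvdE dvdnn.
Qed.

End ModelCycles.

(** * Equivariant embeddings of the model *)

Lemma iter_equivariant (A B : Type) (g : A -> A) (f : B -> B) (u : A -> B) :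
  (forall x, u (g x) = f (u x)) ->
  forall q x, u (iter q g x) = iter q f (u x).
Proof. by move=> ug; elim=> //= q IHq x; rewrite ug IHq. Qed.

Lemma order_equivariant (A B : finType) (g : A -> A) (f : B -> B) (u : A -> B) :
  injective g -> injective f -> injective u ->
  (forall x, u (g x) = f (u x)) -> forall x, forder f (u x) = forder g x.
Proof.
move=> g_inj f_inj u_inj ug x.
have dvdE q : (forder f (u x) %| q) = (forder g x %| q).
  rewrite -(iter_eq_dvdn f_inj) -(iter_eq_dvdn g_inj).
  by rewrite -(iter_equivariant ug) (inj_eq u_inj).
by apply/eqP; rewrite eqn_dvd dvdE dvdnn -dvdE dvdnn.
Qed.

Section CycleType.
Variables (T : finType) (f : T -> T) (n : nat) (m : 'I_n -> nat).
Hypothesis f_inj : injective f.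
Local Notation X := (cycle_points m).

Definition cycle_param : pred {ffun X -> T} :=
  [pred u : {ffun X -> T} | injectiveb u & [forall x, u (rotate x) == f (u x)]].

Lemma cycle_paramP (u : {ffun X -> T}) :
  reflect (injective u /\ forall x, u (rotate x) = f (u x)) (u \in cycle_param).
Proof.
rewrite inE; apply: (iffP andP) => [[/injectiveP ui /forallP uc]|[ui uc]].
  by split=> // x; apply/eqP.
by split; [exact/injectiveP | apply/forallP => x; rewrite uc].
Qed.

(** Equal cardinalities make [u] a bijection, and it preserves orders, so the numbers of points of
    each order agree. *)
Lemma fcard_cycle_param (u : {ffun X -> T}) : #|X| = #|T| ->
  u \in cycle_param -> forall i : 'I_n, fcard f (order_set f i.+1) = m i.
Proof.
move=> XT /cycle_paramP[ui uc] i.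
apply/eqP; rewrite -(eqn_pmul2r (ltn0Sn i)) card_order_set //.
rewrite -card_tag_cycle_points -(card_image ui); apply/eqP/eq_card => y.
have [v uK vK] : bijective u by apply: inj_card_bij; rewrite ?XT.
rewrite -[y]vK (mem_image ui) !inE.
by rewrite (order_equivariant (@rotate_inj _ m) f_inj ui uc) order_rotate eqSS.
Qed.

(** An embedding is determined by the images of the points at position [ord0], one per model cycle.
    For each length these form a transversal, and any choice of transversals extends by iterating
    [f]. *)
Lemma card_cycle_param : (forall i : 'I_n, fcard f (order_set f i.+1) = m i) ->
  #|cycle_param| = \prod_(i < n) ((m i)`! * i.+1 ^ m i).
Proof.
move=> fm; have symf := fconnect_sym f_inj.
transitivity (\prod_(i < n) #|transversal_fun f 'I_(m i) i.+1|); last first.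
  by apply: eq_bigr => i _; rewrite -fm card_transversal_fun.
rewrite -(card_family_prod (fun i => transversal_fun f 'I_(m i) i.+1)).
pose U (u : {ffun X -> T}) : {dffun forall i, {ffun 'I_(m i) -> T}} :=
  [ffun i => [ffun a => u (cycle_point a ord0)]].
pose V (g : {dffun forall i, {ffun 'I_(m i) -> T}}) : {ffun X -> T} :=
  [ffun x : X => iter (tagged x).2 f (g (tag x) (tagged x).1)].
have rot_ord0 i (a : 'I_(m i)) (b : 'I_i.+1) :
    iter b (@rotate _ m) (cycle_point a ord0) = cycle_point a b.
  rewrite iter_rotate; congr cycle_point; apply: val_inj.
  by rewrite /= iter_ordS add0n modn_small.
apply: (can2_in_eq_card (u := U) (v := V)).
- move=> u /cycle_paramP[ui uc]; apply/familyP => i; rewrite inE.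
  apply/andP; split.
    apply/forallP => a; rewrite !ffunE /order_set /=.
    by rewrite (order_equivariant (@rotate_inj _ m) f_inj ui uc) order_rotate.
  apply/injectiveP => a a'; rewrite !ffunE => /eqP.
  rewrite (root_connect symf) => /iter_findex.
  rewrite -(iter_equivariant uc) iter_rotate => /ui /eqP.
  by rewrite -tag_eqE /tag_eq eqxx /= tagged_asE xpair_eqE => /andP[/eqP].
- move=> g /familyP gP.
  have g_ord i a : forder f (g i a) = i.+1.
    by have /andP[/forallP/(_ a)/eqP] := gP i.
  apply/cycle_paramP; split; last first.
    (* At the last position [ordS] wraps to 0, which agrees with [f] because [g i a] has order
       [i.+1]. *)
    case=> i [a b]; rewrite !ffunE /= -iterS.
    by rewrite -[in RHS](iter_mod_order f_inj) g_ord.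
  (* Equal images lie in one cycle, which fixes the length [i], then the number [a] of the cycle,
     then the position [b] below its length. *)
  case=> i [a b] [i' [a' b']]; rewrite !ffunE /= => eq_it.
  have eq_root : froot f (g i a) = froot f (g i' a').
    apply/eqP; rewrite (root_connect symf).
    apply: connect_trans (fconnect_iter f b _) _.
    by rewrite eq_it symf fconnect_iter.
  have eq_i : i = i'.
    apply/val_inj/succn_inj.
    by rewrite -(g_ord _ a) -order_froot // eq_root order_froot.
  case: i' / eq_i a' b' eq_it eq_root => a' b' eq_it eq_root.
  have eq_a : a = a'.
    have /andP[_ /injectiveP inj_g] := gP i.
    by apply: inj_g; rewrite !ffunE.
  rewrite -eq_a in eq_it *; congr cycle_point; apply: val_inj => /=.
  by rewrite -(@findex_iter _ f (g i a) b) ?eq_it ?findex_iter ?g_ord.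
- move=> u /cycle_paramP[ui uc]; apply/ffunP => -[i [a b]].
  by rewrite !ffunE /= -(iter_equivariant uc) rot_ord0.
- by move=> g _; apply/ffunP => i; apply/ffunP => a; rewrite !ffunE.
Qed.

End CycleType.

(** * Cycle types and the number of permutations of each type *)

Section PermCycleType.
Variable M : finType.
Local Notation n := #|M|.
Implicit Types (s t : {perm M}) (j : {ffun 'I_n -> 'I_n.+1}).

(** [inord] never falls back to its default: there are at most as many cycles as points. *)
Definition cycle_type t : {ffun 'I_n -> 'I_n.+1} :=
  [ffun i : 'I_n => inord (fcard t (order_set t i.+1))].

Lemma cycle_typeE t (i : 'I_n) : cycle_type t i = fcard t (order_set t i.+1) :> nat.
Proof.
rewrite ffunE inordK // ltnS.
apply: leq_trans (max_card (order_set t i.+1)).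
by rewrite -(card_order_set (@perm_inj _ t)) leq_pmulr.
Qed.

(** Divisors of an lcm may exceed [n]; there both sides vanish, as no cycle is that long. *)
Lemma mult_cycle_type t (d : nat) : 0 < d ->
  mult (cycle_type t) d = fcard t (order_set t d).
Proof.
case: d => // d _; case: (ltnP d n) => [d_n|n_d].
  by rewrite (mult_ord _ (Ordinal d_n)) cycle_typeE.
rewrite mult_gt //; apply/esym/eqP; rewrite -(eqn_pmul2r (ltn0Sn d)) mul0n.
rewrite (card_order_set (@perm_inj _ t)) eq_card0 // => x.
by rewrite !inE; apply/ltn_eqF; rewrite ltnS (leq_trans _ n_d) ?max_card.
Qed.

Lemma big_mult (R : Type) (idx : R) (op : Monoid.law idx) j (F : nat -> nat -> R) :
  \big[op/idx]_(1 <= i < n.+1) F i (mult j i)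
    = \big[op/idx]_(i < n) F i.+1 (j i).
Proof.
by rewrite big_add1 big_mkord; apply: eq_bigr => i _; rewrite mult_ord.
Qed.

Lemma cycle_type_Jset t : cycle_type t \in Jset n.
Proof.
rewrite inE (big_mult _ _ (fun i c => i * c)).
have ord_lt x : (forder t x).-1 < n.
  by rewrite fingraph.orderSpred; exact: max_card.
rewrite -[X in _ == X]sum1_card (partition_big (fun x => Ordinal (ord_lt x)) predT) //=.
apply/eqP/eq_bigr => i _; rewrite cycle_typeE mulnC.
rewrite (card_order_set (@perm_inj _ t)) sum1_card; apply: eq_card => x.
by rewrite inE -(fingraph.orderSpred t x) eqSS.
Qed.

Lemma card_cycle_type j : j \in Jset n ->
  #|[pred t | cycle_type t == j]|
    * \prod_(1 <= i < n.+1) (i ^ mult j i * (mult j i)`!) = n`!.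
Proof.
rewrite inE (big_mult _ _ (fun i c => i * c)) => /eqP jn.
pose m (i : 'I_n) : nat := j i.
have XM : #|cycle_points m| = n by rewrite card_cycle_points.
have typeP t : (cycle_type t == j) =
    [forall i : 'I_n, fcard t (order_set t i.+1) == m i].
  apply/eqP/forallP => [tj i | tj]; first by rewrite -cycle_typeE tj.
  by apply/ffunP => i; apply: val_inj; rewrite /= cycle_typeE; exact/eqP.
pose Z := \prod_(i < n) ((m i)`! * i.+1 ^ m i).
have -> : \prod_(1 <= i < n.+1) (i ^ mult j i * (mult j i)`!) = Z.
  rewrite (big_mult _ _ (fun i c => i ^ c * c`!)).
  by apply: eq_bigr => i _; rewrite mulnC.
(* Pairs of a permutation [t] and an embedding of the model into [t] are counted twice. By [t]: only
   those of type [j] admit embeddings, [Z] each. *)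
transitivity (\sum_(t : {perm M}) #|cycle_param t (m := m)|).
  rewrite -sum_nat_const [RHS](bigID (fun t => cycle_type t == j)) /=.
  rewrite [X in _ = _ + X]big1 ?addn0 => [|t tj].
    apply: eq_bigr => t; rewrite inE typeP => /forallP tj.
    by rewrite card_cycle_param //; [exact: perm_inj | move=> i; exact/eqP].
  apply/eqP; rewrite -leqn0 leqNgt; apply: contra tj => /card_gt0P[u uP].
  rewrite typeP; apply/forallP => i; apply/eqP.
  by apply: (fcard_cycle_param _ XM uP); exact: perm_inj.
(* By [u]: each of the [n!] injections is bijective and belongs to exactly one [t], the conjugate of
   [rotate] by [u]. *)
rewrite -(ffactnn n) -[X in _ ^_ X]XM -(card_inj_ffuns _ M) -sum1_card.
rewrite (eq_bigr (fun t => \sum_(u in cycle_param t (m := m)) 1)) => [|t _]; last first.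
  by rewrite sum1_card.
rewrite (exchange_big_dep (fun u : {ffun cycle_points m -> M} => injectiveb u)) /=; last first.
  by move=> t u _; rewrite inE => /andP[].
apply: eq_big => [u|u /injectiveP ui]; first by rewrite inE.
rewrite sum1_card.
have [v uK vK] : bijective u by apply: inj_card_bij; rewrite ?XM.
have c_inj : injective (fun x => u (rotate (v x))).
  by move=> x y /ui /rotate_inj /(can_inj vK).
rewrite -(card1 (perm c_inj)); apply: eq_card => t.
rewrite [RHS]inE; apply/cycle_paramP/eqP => [[_ uc]|->].
  by apply/permP => x; rewrite permE uc vK.
by split=> // x; rewrite permE uK.
Qed.

(** * The transport action, its orbits and its fixed points *)

Variable k : nat.
Local Notation magma := {ffun k.-tuple M -> M}.

Definition transport (f : magma) (s : {perm M}) : magma :=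
  [ffun a => s (f (map_tuple s^-1%g a))].

Lemma transport_is_action : is_action [set: {perm M}] transport.
Proof.
apply: is_total_action => [f|f s t]; apply/ffunP => a; rewrite !ffunE.
  by rewrite perm1; congr (f _); apply: eq_from_tnth => i; rewrite tnth_map invg1 perm1.
rewrite permM; congr (t (s (f _))); apply: eq_from_tnth => i.
by rewrite !tnth_map invMg permM.
Qed.

Canonical transport_action := Action transport_is_action.

Lemma map_permK s : cancel (@map_tuple k M M s) (@map_tuple k M M s^-1%g).
Proof. by move=> a; apply: eq_from_tnth => i; rewrite !tnth_map permK. Qed.

Lemma map_permKV s : cancel (@map_tuple k M M s^-1%g) (@map_tuple k M M s).
Proof. by move=> a; apply: eq_from_tnth => i; rewrite !tnth_map permKV. Qed.

Lemma transportP (f g : magma) s :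
  reflect (forall a, s (f a) = g (map_tuple s a)) (transport f s == g).
Proof.
apply: (iffP eqP) => [<- a | fg]; first by rewrite ffunE map_permK.
by apply/ffunP => a; rewrite ffunE fg map_permKV.
Qed.

Lemma magma_iso_classes_orbits :
  magma_iso_classes k M
    = [set orbit transport_action [set: {perm M}] f | f in [set: magma]].
Proof.
apply: eq_imset => f; apply/setP => g; rewrite !inE /=.
apply/existsP/orbitP => [[s /forallP fg]|[s _ /eqP/transportP fg]]; exists s => //.
  by apply/eqP/transportP => a; exact/eqP.
by apply/forallP => a; rewrite fg.
Qed.

(** Being fixed by [s] means that [s] is an automorphism of the magma, so its operation is
    equivariant and [card_tuple_equivariant] applies. *)
Lemma card_Fix_transport s :
  #|'Fix_([set: magma] | transport_action)[s]%g|
    = \prod_(r : k.-tuple 'I_n)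
        (\sum_(d <- divisors (lcm_entries r)) d * mult (cycle_type s) d)
          ^ (((\prod_(i < k) entry r i) %/ lcm_entries r)
              * \prod_(i < k) mult (cycle_type s) (entry r i)).
Proof.
transitivity #|[pred f : magma | [forall a, f (map_tuple s a) == s (f a)]]|.
  apply: eq_card => f; rewrite !inE sub1set inE.
  apply/transportP/forallP => fs a; first by rewrite fs.
  by rewrite (eqP (fs a)).
rewrite card_tuple_equivariant; last exact: perm_inj.
apply: eq_bigr => r _; congr (_ ^ (_ * _)).
  rewrite big_seq [RHS]big_seq; apply: eq_bigr => d.
  rewrite -dvdn_divisors ?lcm_entries_gt0 // => /dvdn_gt0 d_gt0.
  by rewrite mult_cycle_type ?d_gt0 ?lcm_entries_gt0.
by apply: eq_bigr => i _; rewrite mult_cycle_type.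
Qed.

End PermCycleType.

(** * Burnside's formula, summed by cycle type *)

Import GRing.Theory.
Local Open Scope ring_scope.

Theorem theorem11 (k n : nat) (M : finType) (hM : #|M| = n) :
  #|magma_iso_classes k M|%:R =
  \sum_(j in Jset n)
     (1 / (\prod_(1 <= i < n.+1) (i ^ mult j i * (mult j i)`!))%N%:R)
     * (\prod_(r : k.-tuple 'I_n)
          (\sum_(d <- divisors (lcm_entries r)) d * mult j d)
            ^ (((\prod_(i < k) entry r i) %/ lcm_entries r)
                 * \prod_(i < k) mult j (entry r i)))%N%:R :> rat.
Proof.
case: n / hM.
have fact_neq0 : #|M|`!%:R != 0 :> rat.
  by rewrite Num.Theory.pnatr_eq0 -lt0n fact_gt0.
(* Multiplying by [n!], the order of the group, turns the left side into the sum of the fixed-point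
   counts. *)
apply: (mulIf fact_neq0); rewrite -natrM mulr_suml.
have acts : [acts [set: {perm M}], on [set: {ffun k.-tuple M -> M}]
              | transport_action M k].
  by apply/subsetP => s _; rewrite !inE; apply/subsetP => f; rewrite !inE.
have card_perms : #|[set: {perm M}]| = #|M|`!.
  rewrite -[in RHS]cardsT -card_perm; apply: eq_card => s.
  by rewrite !inE; apply/esym/subsetP => x; rewrite inE.
rewrite -[in LHS]card_perms magma_iso_classes_orbits -(Frobenius_Cauchy acts).
rewrite (partition_big (@cycle_type M) (mem (Jset #|M|))) /=; last first.
  by move=> s _; exact: cycle_type_Jset.
rewrite natr_sum; apply: eq_bigr => j jJ.
set W := (\prod_r _)%N; set Z := (\prod_(1 <= i < _) _)%N.
rewrite (eq_bigr (fun=> W)) => [|s /andP[_ /eqP sj]]; last first.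
  by rewrite /W -sj card_Fix_transport.
(* All permutations of type [j] fix [W] magmas. Writing [n!] as their number times [Z] lets [Z]
   cancel. *)
rewrite sum_nat_const -(card_cycle_type jJ) -/Z.
rewrite (eq_card (B := [pred t | cycle_type t == j])) => [|s]; last first.
  by rewrite unfold_in /= !inE.
have Z_neq0 : Z%:R != 0 :> rat.
  by apply: contraNneq fact_neq0; rewrite -(card_cycle_type jJ) -/Z natrM => ->; rewrite mulr0.
by rewrite mul1r [RHS]mulrC !natrM mulrA mulfK.
Qed.
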